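(* Let $g(z)=z+b_1+b_2z^{-1}+b_3z^{-2}+\dots$ and let $\beta_{nk}$ ($n,k\ge1$) be its Grunsky coefficients. Then $$\beta_{nk}=n\sum_{\mathbf m:\ \|\mathbf m\|=n+k,\ m_1=0}\frac{b^{\mathbf m}\,(|\mathbf m|-1)!}{\prod_j m_j!}\ \mathcal P_{k-|\mathbf m|}\bigl(L_1,\dots,L_{k-|\mathbf m|}\bigr),$$ where, for each $\mathbf m$ and each integer $p\ge 1$, $$L_p=-\sum_{j\ge2}m_{j+1}+\sum_{j\ge2,\ j\mid p} j\,m_{j+1}.$$
   Context: The sum is over sequences $\mathbf m=(m_1,m_2,\dots)$ of nonnegative integers with finitely many nonzero entries; $|\mathbf m|=\sum_j m_j$, $\|\mathbf m\|=\sum_j j\,m_j$, $b^{\mathbf m}=b_1^{m_1}b_2^{m_2}b_3^{m_3}\cdots$. Grunsky coefficients: for each $n\ge1$ there is a unique polynomial $\Phi_n$ in one variable (the Faber polynomial of $g$) such that $\Phi_n(g(z))=z^n+\sum_{k>0}\beta_{nk}z^{-k}$; the numbers $\beta_{nk}$ are the Grunsky coefficients of $g$. Equivalently, $\sum_{n,k\ge1}\beta_{nk}z^{-k}\zeta^{-n}=\zeta\frac{\partial}{\partial\zeta}\ln\frac{g(\zeta)-g(z)}{\zeta-z}$ (formal series in $z^{-1},\zeta^{-1}$). The Waring polynomials $\mathcal P_n(a_1,\dots,a_n)$ are defined by $\mathcal P_0=1$ and $\exp\bigl\{-\sum_{j\ge1}\frac1j a_jz^j\bigr\}=\sum_{n\ge0}\mathcal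 P_n(a_1,\dots,a_n)z^n$; by convention $\mathcal P_n=0$ for $n<0$. *)

(* Defs.v *)
From HB Require Import structures.
From mathcomp Require Import all_boot all_order all_algebra.

Set Implicit Arguments.
Unset Strict Implicit.
Unset Printing Implicit Defensive.

Import Order.TTheory GRing.Theory Num.Theory.
Local Open Scope ring_scope.

(* A formal power series \sum_i f_i t^i is its coefficient sequence
   f : nat -> K. *)

Definition fps_mul (K : fieldType) (f h : nat -> K) : nat -> K :=
  fun n => \sum_(i < n.+1) f i * h (n - i)%N.

Definition fps_one (K : fieldType) : nat -> K := fun n => (n == 0)%:R.

Definition fps_pow (K : fieldType) (f : nat -> K) (i : nat) : nat -> K :=
  iter i (fps_mul f) (@fps_one K).

(* exp(f) = \sum_i f^i / i!, meant for f 0 = 0: the terms i > n then do not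
   contribute to the coefficient of t^n (fps_pow_eq0). *)
Definition fps_exp (K : fieldType) (f : nat -> K) : nat -> K :=
  fun n => \sum_(i < n.+1) fps_pow f i n / (i`!)%:R.

(* LSeries d f is the formal Laurent series \sum_(i >= 0) f i z^(d - i)
   in z^-1. *)
Record lseries (K : fieldType) := LSeries { ldeg : nat; ltail : nat -> K }.

Definition lcoef (K : fieldType) (f : lseries K) (e : int) : K :=
  if e <= (ldeg f)%:Z then ltail f `|(ldeg f)%:Z - e|%N else 0.

Definition lmul (K : fieldType) (f h : lseries K) : lseries K :=
  LSeries (ldeg f + ldeg h)%N (fps_mul (ltail f) (ltail h)).

Definition lone (K : fieldType) : lseries K := LSeries 0 (@fps_one K).

Definition lpow (K : fieldType) (f : lseries K) (i : nat) : lseries K :=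
  iter i (lmul f) (lone K).

(* The coefficient of z^e in P(f). *)
Definition lhorner_coef (K : fieldType) (P : {poly K}) (f : lseries K)
    (e : int) : K :=
  \sum_(i < size P) P`_i * lcoef (lpow f i) e.

(* g(z) = z + b_1 + b_2 z^-1 + b_3 z^-2 + ...; the value b 0 is not used. *)
Definition gseries (K : fieldType) (b : nat -> K) : lseries K :=
  LSeries 1 (fun i => if i == 0%N then 1 else b i).

(* P(g(z)) = z^n + \sum_(k > 0) beta_k z^-k for some beta. *)
Definition is_faber (K : fieldType) (b : nat -> K) (n : nat) (P : {poly K}) :=
  forall e : nat, lhorner_coef P (gseries b) e%:Z = (e == n)%:R.

(* The coefficients of z^(n-1), ..., z^0 in 'X^n evaluated at g are cancelled
   in this order; faberP and faber_unique show that the result is the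
   polynomial specified by is_faber. *)
Definition faber (K : fieldType) (b : nat -> K) (n : nat) : {poly K} :=
  foldr (fun d P => P - lhorner_coef P (gseries b) d%:Z *: 'X^d)
        'X^n (iota 0 n).

Definition grunsky (K : fieldType) (b : nat -> K) (n k : nat) : K :=
  lhorner_coef (faber b n) (gseries b) (- k%:Z).

(* P_n(a_1, ..., a_n), with the convention P_n = 0 for n < 0; the value a 0 is
   not used. *)
Definition waring (K : fieldType) (a : nat -> K) (n : int) : K :=
  match n with
  | Posz n' => fps_exp (fun j => if j == 0%N then 0 else - (a j / j%:R)) n'
  | Negz _ => 0
  end.

(* The finitely supported sequence (m_1, m_2, ...) is encoded by a list
   [:: m_1; ...; m_N], entries beyond the end being 0; mi_entry m j is m_j for
   j >= 1. *)
Definition mi_entry (m : seq nat) (j : nat) : nat := nth 0%N (0%N :: m) j.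

Definition mi_abs (m : seq nat) : nat :=
  (\sum_(1 <= j < (size m).+1) mi_entry m j)%N.

Definition mi_norm (m : seq nat) : nat :=
  (\sum_(1 <= j < (size m).+1) j * mi_entry m j)%N.

Definition mi_fact (m : seq nat) : nat :=
  (\prod_(1 <= j < (size m).+1) (mi_entry m j)`!)%N.

Definition mi_pow (K : fieldType) (b : nat -> K) (m : seq nat) : K :=
  \prod_(1 <= j < (size m).+1) b j ^+ mi_entry m j.

(* L_p; only j < size m matters, as m_(j+1) = 0 otherwise. *)
Definition mi_L (K : fieldType) (m : seq nat) (p : nat) : K :=
  - (\sum_(2 <= j < size m) mi_entry m j.+1)%N%:R
  + (\sum_(2 <= j < size m | (j %| p)%N) j * mi_entry m j.+1)%N%:R.

(* If ||m|| = N then m_j = 0 for j > N and m_j <= N for all j >= 1, so these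
   sequences are represented by N.-tuples of integers in {0, ..., N}; see
   mi_complete. *)
Definition mi_seq (N : nat) (t : N.-tuple 'I_N.+1) : seq nat :=
  [seq val i | i <- t].

Lemma fps_pow_eq0 (K : fieldType) (f : nat -> K) (i n : nat) :
  f 0%N = 0 -> (n < i)%N -> fps_pow f i n = 0.
Proof.
move=> f0; elim: i n => [//|i IHi] n lt_n_i1.
rewrite /fps_pow iterS -/(fps_pow f i) /fps_mul big1 // => -[[|j] ltj] _ /=.
  by rewrite f0 mul0r.
rewrite IHi ?mulr0 //; case: n lt_n_i1 ltj => // n lt_n_i _.
by rewrite subSS (leq_ltn_trans (leq_subr _ _)).
Qed.

Lemma ldeg_lpow (K : fieldType) (b : nat -> K) (i : nat) :
  ldeg (lpow (gseries b) i) = i.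
Proof. by elim: i => //= i ->. Qed.

Lemma lcoef_lpow_lead (K : fieldType) (b : nat -> K) (i : nat) :
  lcoef (lpow (gseries b) i) i%:Z = 1.
Proof.
rewrite /lcoef ldeg_lpow lexx subrr /=.
elim: i => [//|i IHi] /=.
by rewrite /fps_mul big_ord1 /= mul1r IHi.
Qed.

Lemma lcoef_lpow_gt (K : fieldType) (b : nat -> K) (i e : nat) :
  (i < e)%N -> lcoef (lpow (gseries b) i) e%:Z = 0.
Proof. by move=> ltie; rewrite /lcoef ldeg_lpow lez_nat leqNgt ltie. Qed.

Lemma lhorner_coef_wide (K : fieldType) (P : {poly K}) f e (N : nat) :
  (size P <= N)%N ->
  lhorner_coef P f e = \sum_(i < N) P`_i * lcoef (lpow f i) e.
Proof.
move=> leN; rewrite /lhorner_coef.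
rewrite (big_ord_widen N (fun i => P`_i * lcoef (lpow f i) e)) //.
rewrite big_mkcond; apply: eq_bigr => i _.
by case: ltnP => // le_i; rewrite nth_default // mul0r.
Qed.

Lemma lhorner_coefB (K : fieldType) (P Q : {poly K}) f e :
  lhorner_coef (P - Q) f e = lhorner_coef P f e - lhorner_coef Q f e.
Proof.
pose N := maxn (size P) (size Q).
rewrite (@lhorner_coef_wide _ P _ _ N) ?leq_maxl //.
rewrite (@lhorner_coef_wide _ Q _ _ N) ?leq_maxr //.
rewrite (@lhorner_coef_wide _ (P - Q) _ _ N); last first.
  by rewrite (leq_trans (size_polyD _ _)) // size_polyN.
by rewrite -sumrB; apply: eq_bigr => i _; rewrite coefB mulrBl.
Qed.

Lemma lhorner_coefZXn (K : fieldType) (c : K) (d : nat) f e :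
  lhorner_coef (c *: 'X^d) f e = c * lcoef (lpow f d) e.
Proof.
rewrite (@lhorner_coef_wide _ _ _ _ d.+1); last first.
  by rewrite (leq_trans (size_scale_leq _ _)) // size_polyXn.
rewrite big_ord_recr /= big1 ?add0r => [|i _].
  by rewrite coefZ coefXn eqxx mulr1.
by rewrite coefZ coefXn (ltn_eqF (ltn_ord i)) mulr0 mul0r.
Qed.

Lemma faberP (K : fieldType) (b : nat -> K) (n : nat) :
  is_faber b n (faber b n).
Proof.
suff H d0 l : (d0 + l = n)%N -> forall e : nat, (d0 <= e)%N ->
    lhorner_coef
      (foldr (fun d P => P - lhorner_coef P (gseries b) d%:Z *: 'X^d)
         'X^n (iota d0 l)) (gseries b) e%:Z = (e == n)%:R.
  by move=> e; apply: H.
elim: l d0 => [|l IHl] d0 /= Hn e le_d0_e.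
  rewrite -['X^n]scale1r lhorner_coefZXn mul1r.
  have [->|ne] := eqVneq e n; first by rewrite lcoef_lpow_lead.
  rewrite addn0 in Hn; rewrite Hn in le_d0_e.
  by rewrite lcoef_lpow_gt // ltn_neqAle eq_sym ne.
rewrite lhorner_coefB lhorner_coefZXn.
have [->|ne] := eqVneq e d0.
  rewrite lcoef_lpow_lead mulr1 subrr.
  by rewrite -Hn -{1}[d0]addn0 eqn_add2l.
have lt_d0_e : (d0 < e)%N by rewrite ltn_neqAle eq_sym ne.
by rewrite lcoef_lpow_gt // mulr0 subr0 IHl // addSnnS.
Qed.

Lemma faber_unique (K : fieldType) (b : nat -> K) (n : nat) (P : {poly K}) :
  is_faber b n P -> P = faber b n.
Proof.
move=> HP; apply/eqP; rewrite -subr_eq0; set D := P - _.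
have HD (e : nat) : lhorner_coef D (gseries b) e%:Z = 0.
  by rewrite lhorner_coefB HP faberP subrr.
apply: contraT => D0.
move: (HD (size D).-1).
rewrite (@lhorner_coef_wide _ _ _ _ (size D).-1.+1) ?leqSpred //.
rewrite big_ord_recr /= lcoef_lpow_lead mulr1.
rewrite big1 => [|i _]; last by rewrite lcoef_lpow_gt ?mulr0.
by rewrite add0r => /eqP; rewrite -/(lead_coef D) lead_coef_eq0 (negPf D0).
Qed.

Lemma mi_complete (N M : nat) (s : nat -> nat) :
  s 0%N = 0%N -> (forall j, (M < j)%N -> s j = 0%N) ->
  (\sum_(1 <= j < M.+1) j * s j)%N = N ->
  exists! t : N.-tuple 'I_N.+1, forall j, mi_entry (mi_seq t) j = s j.
Proof.
move=> s0 sM sN.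
have le_js j : (j * s j <= N)%N.
  case: j => [|j]; first by rewrite mul0n.
  have [lt_Mj|le_jM] := ltnP M j.+1; first by rewrite sM // muln0.
  rewrite -sN (bigD1_seq j.+1) ?iota_uniq ?leq_addr //.
  by rewrite mem_index_iota.
have le_sN j : (s j <= N)%N.
  case: j => [|j]; first by rewrite s0.
  by apply: leq_trans (le_js j.+1); rewrite leq_pmull.
have sgt j : (N < j)%N -> s j = 0%N.
  move=> ltNj; apply/eqP; rewrite -leqn0 leqNgt; apply/negP => sj.
  by have := leq_trans (leq_pmulr j sj) (le_js j); rewrite leqNgt ltNj.
exists [tuple inord (s i.+1) | i < N]; split=> [j|t Ht].
  case: j => [|j]; first by rewrite s0.
  rewrite /mi_entry /mi_seq /=.
  have [ltjN|lejN] := ltnP j N; last first.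
    by rewrite nth_default ?sgt // !size_map -enumT size_enum_ord.
  rewrite (nth_map ord0); last by rewrite size_map size_enum_ord.
  rewrite (_ : nth _ _ _ = tnth [tuple inord (s i.+1) | i < N] (Ordinal ltjN)).
    by rewrite tnth_mktuple inordK // ltnS.
  by rewrite (tnth_nth ord0).
apply: eq_from_tnth => i; rewrite tnth_mktuple; apply: val_inj.
rewrite /= inordK ?ltnS // -Ht /mi_entry /mi_seq /=.
by rewrite (nth_map ord0) ?size_tuple // (tnth_nth ord0).
Qed.

(* Main.v *)
Require Import Defs.
From HB Require Import structures.
From mathcomp Require Import all_boot all_order all_algebra.
From mathcomp Require Import ring zify.

(** Put [x = 1/z] and [y = 1/zeta]. Then
      [g(zeta) - g(z) = (zeta - z) H],
      [H = 1 - \sum_(i >= 1) b_(i+1) (x^i y + x^(i-1) y^2 + ... + x y^i)],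
    and the Grunsky coefficients are the coefficients of
    [B = y d/dy (- ln H)], that is, [\beta_nk] is [n] times the coefficient of
    [x^k y^n] in [- ln H = \sum_(r >= 1) (1 - H)^r / r].

    Since [\beta_nk] is defined by Faber polynomials, this first has to be
    established. Written as [H B = - y dH/dy], it is a recursion for the
    coefficients of [B], and the [\beta_nk] obey the same one ([grunsky_rec]):
    the Faber polynomial of index [n + 1] is a combination of [X] times the
    previous one and of lower ones ([faberS]), which gives the recursion
    multiplied by [(x - y) / (x y)], and a telescoping sum undoes this
    multiplication. The comparison is [grunsky_log].

    Expanding [(1 - H)^r / r] by the multinomial theorem ([multinomial],
    [log_series_coef]), a multi-index [m] with [m_1 = 0] contributes
    [(|m|-1)! b^m / \prod_j m_j!] times the product of the
    [(x^i y + ... + x y^i)^(m_(i+1))]. This product is homogeneous of degree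
    [||m||], hence only [||m|| = n + k] matters and one may set [y = 1]: what
    remains is the coefficient of [x^(k-|m|)] in
    [\prod_i (1 + x + ... + x^(i-1))^(m_(i+1))]. Each factor is
    [(1 - x^i) / (1 - x)], so the logarithm of the product is
    [- \sum_p L_p x^p / p], and the coefficient is the value of the Waring
    polynomial ([waring_mi_L]).

    Power series are represented by truncated polynomials; in
    [{poly {poly K}}] the outer variable is [y] and the inner one [x]. A term
    [i = 0], equal to zero, is kept in the sum defining [H], so that the
    condition [m_1 = 0] appears as the vanishing of a power of it. *)

Set Implicit Arguments.
Unset Strict Implicit.
Unset Printing Implicit Defensive.

Import Order.TTheory GRing.Theory Num.Theory.
Local Open Scope ring_scope.

(** * A recursion for the Grunsky coefficients *)

(** The bound [M] only has to be large enough; leaving it free lets one range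
    of summation serve all the powers of a series that occur in a polynomial. *)
Lemma lcoef_lmul (K : fieldType) (f h : lseries K) (e : int) (M : nat) :
  (ldeg f)%:Z + (ldeg h)%:Z - e < M%:Z ->
  lcoef (lmul f h) e =
  \sum_(j < M) ltail f j * lcoef h (e + j%:Z - (ldeg f)%:Z).
Proof.
move=> ltM; rewrite {1}/lcoef /= PoszD.
have [le_e|gt_e] := leP e ((ldeg f)%:Z + (ldeg h)%:Z); last first.
  by rewrite big1 // => j _; rewrite /lcoef ifN ?mulr0 //; lia.
set d := `|_|%N; have d_def : d%:Z = (ldeg f)%:Z + (ldeg h)%:Z - e by lia.
have ltdM : (d.+1 <= M)%N by lia.
rewrite /fps_mul (big_ord_widen M (fun i => ltail f i * ltail h (d - i)%N)) //.
rewrite big_mkcond; apply: eq_bigr => j _ /=; rewrite /lcoef.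
case: ltnP => [ltj|lej]; last by rewrite ifN ?mulr0 //; lia.
rewrite ifT; last by lia.
by congr (_ * ltail h _); lia.
Qed.

Lemma lhorner_coefXM (K : fieldType) (b : nat -> K) (P : {poly K}) (e : int)
    (M : nat) :
  (size P).+1%:Z - e < M%:Z ->
  lhorner_coef ('X * P) (gseries b) e =
  \sum_(j < M) ltail (gseries b) j
               * lhorner_coef P (gseries b) (e + j%:Z - 1).
Proof.
move=> ltM; rewrite (@lhorner_coef_wide _ _ _ _ (size P).+1); last first.
  by rewrite (leq_trans (size_polyMleq _ _)) // size_polyX.
rewrite big_ord_recl coefXM mul0r add0r.
under [RHS]eq_bigr do rewrite mulr_sumr.
rewrite exchange_big; apply: eq_bigr => -[i lti] _ /=.
rewrite /bump /= add1n coefXM /= (@lcoef_lmul _ _ _ _ M); last first.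
  by rewrite ldeg_lpow /=; lia.
by rewrite mulr_sumr; apply: eq_bigr => j _ /=; rewrite mulrCA.
Qed.

Lemma lhorner_coef_sum (K : fieldType) (f : lseries K) (e : int) (I : finType)
    (c : I -> K) (P : I -> {poly K}) :
  lhorner_coef (\sum_i c i *: P i) f e = \sum_i c i * lhorner_coef (P i) f e.
Proof.
pose M := maxn (size (\sum_i c i *: P i)) (\max_i size (P i)).
rewrite (@lhorner_coef_wide _ _ _ _ M) ?leq_maxl //.
under [RHS]eq_bigr => i _.
  rewrite (@lhorner_coef_wide _ (P i) _ _ M); last first.
    by rewrite leq_max (leq_bigmax i) orbT.
  rewrite mulr_sumr; over.
rewrite exchange_big; apply: eq_bigr => j _ /=.
rewrite coef_sum mulr_suml; apply: eq_bigr => i _.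
by rewrite coefZ mulrA.
Qed.

(** Evaluated at [g], the right-hand side has [z^(n+1)] as its part with
    nonnegative exponents: multiplying [z^n + \sum_k \beta_nk z^-k] by [g]
    produces besides [z^(n+1)] the terms [b_(n-e+1) z^e] for [e <= n], which the
    sum over the lower Faber polynomials removes, and the constant [\beta_n1].
    This property characterizes the Faber polynomial. *)
Lemma faberS (K : fieldType) (b : nat -> K) (n : nat) :
  faber b n.+1 = 'X * faber b n - \sum_(i < n.+1) b i.+1 *: faber b (n - i)%N
                 - grunsky b n 1 *: 'X^0.
Proof.
apply/esym/faber_unique => e.
rewrite !lhorner_coefB lhorner_coefZXn lhorner_coef_sum.
pose M := (size (faber b n) + n).+3.
rewrite (@lhorner_coefXM _ _ _ _ M); last by rewrite /M; lia.
under [X in _ - X - _]eq_bigr do rewrite faberP.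
rewrite big_ord_recl /= mul1r.
have -> : \sum_(i < M.-1) b (bump 0 i)
    * lhorner_coef (faber b n) (gseries b) (e%:Z + (bump 0 i)%:Z - 1) =
    \sum_(i < n.+1) b i.+1 * (e == (n - i)%N)%:R.
  have leM : (n.+1 <= M.-1)%N by rewrite /M; lia.
  rewrite [RHS](big_ord_widen _ (fun i => b i.+1 * (e == (n - i)%N)%:R) leM).
  rewrite [RHS]big_mkcond; apply: eq_bigr => -[i ltiM] _.
  rewrite /bump /= add1n.
  have -> : e%:Z + i.+1%:Z - 1 = (e + i)%N%:Z by lia.
  rewrite faberP; case: ltnP => [lti|gti].
    by congr (_ * _%:R); congr nat_of_bool; apply/eqP/eqP; lia.
  by rewrite (_ : (e + i == n)%N = false) ?mulr0 //; lia.
rewrite addrK; case: e => [|e].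
  by rewrite [lcoef _ _](_ : _ = 1) // mulr1 /grunsky subrr.
have -> : e.+1%:Z + 0%:Z - 1 = e%:Z by lia.
by rewrite faberP eqSS [lcoef _ _](_ : _ = 0) // mulr0 subr0.
Qed.

Lemma grunsky0 (K : fieldType) (b : nat -> K) (k : nat) :
  grunsky b 0 k.+1 = 0.
Proof.
by rewrite /grunsky /faber /= -['X^0]scale1r lhorner_coefZXn mul1r.
Qed.

(** The coefficient of [z^-(k+1)] in the relation of [faberS]. It is the form
    that [H B = - y dH/dy] takes after multiplication by [(x - y) / (x y)], with
    [H] and [B] as in the introduction. The terms containing [b_1] cancel. *)
Lemma grunskyS (K : fieldType) (b : nat -> K) (n k : nat) :
  grunsky b n.+1 k.+1 =
    grunsky b n k.+2 + b (n + k).+2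
    + \sum_(c < k) b c.+2 * grunsky b n (k - c)%N
    - \sum_(a < n) b a.+2 * grunsky b (n - a.+1)%N k.+1.
Proof.
rewrite {1}/grunsky faberS !lhorner_coefB lhorner_coefZXn lhorner_coef_sum.
have -> : lcoef (lpow (gseries b) 0) (- k.+1%:Z) = 0 by [].
rewrite mulr0 subr0.
pose M := (size (faber b n) + n).+1.
rewrite (@lhorner_coefXM _ _ _ _ (k.+2 + M)); last by rewrite /M; lia.
(* The indices [j < k + 2] involve the negative powers of [z] in the value of
   the Faber polynomial at [g], the others its only nonnegative power [z^n]. *)
rewrite big_split_ord /=.
have -> : \sum_(i < M) (if (k.+2 + i)%N == 0%N then 1 else b (k.+2 + i)%N)
    * lhorner_coef (faber b n) (gseries b) (- k.+1%:Z + (k.+2 + i)%N%:Z - 1)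
    = b (n + k).+2.
  have ltnM : (n < M)%N by rewrite /M; lia.
  rewrite (bigD1 (Ordinal ltnM)) //= big1 => [|[i ltiM] /= nei].
    have -> : - k.+1%:Z + (k.+2 + n)%N%:Z - 1 = n%:Z by lia.
    by rewrite faberP eqxx mulr1 addr0; congr b; lia.
  have -> : - k.+1%:Z + (k.+2 + i)%N%:Z - 1 = i%:Z by lia.
  by rewrite faberP [(i == n)%N](negPf nei) mulr0.
rewrite big_ord_recl big_ord_recl /= mul1r.
rewrite [X in _ - X]big_ord_recl /= subn0 /bump /=.
have -> : - k.+1%:Z + 0%:Z - 1 = - k.+2%:Z by lia.
have -> : - k.+1%:Z + (1 + 0)%N%:Z - 1 = - k.+1%:Z by lia.
rewrite -!/(grunsky b n _).
(* The exponents met at [j = c + 2]; [j = 0] and [j = 1] have been split off. *)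
have shift c : (c < k)%N ->
    - k.+1%:Z + (1 + (1 + c))%N%:Z - 1 = - (k - c)%N%:Z by lia.
under [X in _ + (_ + X)]eq_bigr => i _.
  rewrite (shift _ (ltn_ord i)).
  rewrite -/(grunsky b n (k - i)%N); over.
under [X in _ - (_ + X)]eq_bigr => i _ do rewrite -/(grunsky b _ k.+1).
rewrite !add1n.
ring.
Qed.

(** Only indices [>= 1] occur on the right, so the recursion determines all
    [\beta_nk]. It follows from [grunskyS] by telescoping along [n + k]
    constant: the double sum for [\beta_(n,k+1)] and the one for
    [\beta_(n+1,k)] differ by their boundary rows, which are the two single
    sums of [grunskyS]. *)
Lemma grunsky_rec (K : fieldType) (b : nat -> K) (n k : nat) :
  grunsky b n.+1 k.+1 =
    n.+1%:R * b (n + k).+2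
    + \sum_(a < n) \sum_(c < k) b (a + c).+2 * grunsky b (n - a)%N (k - c)%N.
Proof.
elim: n k => [|n IHn] k; rewrite grunskyS.
  rewrite !big_ord0 grunsky0 big1 => [|c _]; last first.
    by rewrite -(subnSK (ltn_ord c)) grunsky0 mulr0.
  by ring.
(* Split off the row [a = 0] on the right, the column [c = 0] and the vanishing
   last term (it contains [\beta_0]) on the left; the rest agrees after a
   shift of indices. *)
rewrite IHn [in RHS]big_ord_recl /=.
under [in X in X + _ + _ - _]eq_bigr do rewrite big_ord_recl /=.
rewrite big_split /=.
rewrite [X in _ - X]big_ord_recr /= subnn grunsky0 mulr0 addr0.
under eq_bigr do rewrite addn0 subn0.
under [X in _ - X]eq_bigr do rewrite subSS.
under [in X in _ = _ + (_ + X)]eq_bigr => a _.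
  under eq_bigr => c _ do rewrite /bump /= add1n subSS addSn.
  over.
under [in X in _ + (_ + X) + _ + _ - _]eq_bigr => a _.
  under eq_bigr => c _ do rewrite /bump /= add1n subSS addnS.
  over.
rewrite /= addnS !addSn.
under [in X in _ = _ + (X + _)]eq_bigr => c _ do rewrite add0n subn0.
rewrite -[n.+2%:R]natr1.
ring.
Qed.

(** * The multinomial theorem in divided-power form *)

(** [p] agrees with [exp(a u)] up to order [N]; [iv r] plays the part of
    [1 / r!] in a ring that need not be a field. *)
Definition divided_powers (A : comNzRingType) (iv : nat -> A) (N : nat) (a : A)
    (p : {poly A}) :=
  forall r, (r <= N)%N -> p`_r = iv r * a ^+ r.

(** [exp(a u) exp(a' u) = exp((a + a') u)], that is, the binomial theorem. *)
Lemma divided_powersM (A : comNzRingType) (iv : nat -> A) (N : nat)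
    (a a' : A) (p p' : {poly A}) :
  (forall r, iv r * (r`!)%:R = 1) ->
  divided_powers iv N a p -> divided_powers iv N a' p' ->
  divided_powers iv N (a + a') (p * p').
Proof.
move=> ivP Ha Ha' r ler; rewrite coefM addrC exprDn mulr_sumr.
apply: eq_bigr => i _; have lei : (i <= r)%N by rewrite -ltnS.
rewrite Ha ?(leq_trans lei) // Ha' ?(leq_trans (leq_subr _ _)) //.
have binE : iv i * iv (r - i)%N = iv r * ('C(r, i))%:R.
  transitivity (iv r * r`!%:R * (iv i * iv (r - i)%N)).
    by rewrite ivP mul1r.
  rewrite -(bin_fact lei) !natrM.
  transitivity (iv r * 'C(r, i)%:R * (iv i * i`!%:R)
                * (iv (r - i)%N * (r - i)`!%:R)); first by ring.
  by rewrite !ivP !mulr1.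
rewrite -mulr_natr mulrACA binE; ring.
Qed.

(** Compare the coefficients of [u^r] in
    [exp(u \sum_i x_i) = \prod_i exp(u x_i)], the factors on the right being
    truncated at order [N]: distributing this finite product over finite sums
    already gives the sum over all exponent vectors. *)
Lemma multinomial (A : comNzRingType) (iv : nat -> A) (N r : nat) (I : finType)
    (x : I -> A) :
  (forall r, iv r * (r`!)%:R = 1) -> (r <= N)%N ->
  iv r * (\sum_i x i) ^+ r =
  \sum_(m : {ffun I -> 'I_N.+1} | (\sum_i m i == r)%N)
     \prod_i (iv (m i) * x i ^+ m i).
Proof.
move=> ivP ler.
pose p i := \sum_(j < N.+1) (iv j * x i ^+ j)%:P * 'X^j.
have dp : divided_powers iv N (\sum_i x i) (\prod_i p i).
  elim/big_ind2: _ => [s les|a q a' q'|i _ s les].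
  - rewrite coefC; case: s les => [|s] _; last by rewrite expr0n mulr0.
    by rewrite expr0 mulr1 -[LHS](ivP 0%N) mulr1.
  - by move=> Ha Ha'; apply: divided_powersM.
  rewrite coef_sum (bigD1 (inord s)) //= coefCM coefXn inordK // eqxx mulr1.
  rewrite big1 ?addr0 // => j nej; rewrite coefCM coefXn.
  case: eqP => [ej|_]; last by rewrite mulr0.
  by case/eqP: nej; apply: val_inj; rewrite /= inordK.
rewrite -dp // bigA_distr_bigA coef_sum [RHS]big_mkcond; apply: eq_bigr => m _.
rewrite big_split /= -rmorph_prod coefCM prodrXr coefXn eq_sym.
by case: eqP => _; rewrite ?mulr1 ?mulr0.
Qed.

(** * Homogeneous polynomials in two variables *)

(** [P] is [\sum_k p_k x^k y^(d-k)], where [y] is the outer and [x] the inner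
    variable. Without the bound on the size of [p] the relation would not be
    stable under products, since [P] would not see the terms of [p] beyond
    [x^d]. *)
Definition bihomogenization (R : nzRingType) (d : nat) (p : {poly R})
    (P : {poly {poly R}}) :=
  (size p <= d.+1)%N /\
  forall n k, P`_n`_k = if (n + k == d)%N then p`_k else 0.

Lemma bihomogenizationM (R : nzRingType) (d e : nat) (p q : {poly R})
    (P Q : {poly {poly R}}) :
  bihomogenization d p P -> bihomogenization e q Q ->
  bihomogenization (d + e) (p * q) (P * Q).
Proof.
move=> [szp coP] [szq coQ]; split.
  by apply: leq_trans (size_polyMleq _ _) _; lia.
move=> n k; rewrite coefM coef_sum coefM.
under eq_bigr => i _ do rewrite coefM.
rewrite exchange_big /=.
have -> : (if (n + k == d + e)%N then \sum_(j < k.+1) p`_j * q`_(k - j) else 0)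
  = \sum_(j < k.+1) (if (n + k == d + e)%N then p`_j * q`_(k - j) else 0).
  by case: eqP => // _; rewrite big1.
apply: eq_bigr => -[j ltj] _ /=.
under eq_bigr => i _ do rewrite coP coQ.
(* For fixed [j] only the term [i = d - j] of the sum over [i] can survive. *)
have [ltdj|ledj] := ltnP d j.
  rewrite (nth_default 0 (leq_trans szp ltdj)) mul0r if_same big1 // => i _.
  by rewrite if_same mul0r.
have [ltek|leek] := ltnP e (k - j).
  rewrite (nth_default 0 (leq_trans szq ltek)) mulr0 if_same big1 // => i _.
  by rewrite if_same mulr0.
have [ltn|len] := ltnP n (d - j).
  rewrite ifN; last by lia.
  rewrite big1 // => -[i lti] _ /=; rewrite ifN ?mul0r //; lia.
have ltdn : (d - j < n.+1)%N by [].
rewrite (bigD1 (Ordinal ltdn)) //= big1 => [|[i lti] /eqP nei /=]; last first.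
  rewrite ifN ?mul0r //.
  by apply/eqP => eid; apply: nei; apply: val_inj => /=; lia.
rewrite addr0 ifT; last by lia.
rewrite (_ : (n - (d - j) + (k - j) == e)%N = (n + k == d + e)%N).
  by case: eqP => _; rewrite ?mulr0.
by apply/eqP/eqP; lia.
Qed.

Lemma bihomogenization1 (R : nzRingType) :
  bihomogenization 0 (1 : {poly R}) (1 : {poly {poly R}}).
Proof.
split=> [|n k]; first by rewrite size_poly1.
by rewrite !coef1; case: n => [|n] /=; rewrite ?coef0 ?coef1 //; case: k.
Qed.

Lemma bihomogenizationZ (R : comNzRingType) (d : nat) (c : R) (p : {poly R})
    (P : {poly {poly R}}) :
  bihomogenization d p P -> bihomogenization d (c *: p) (c%:P%:P * P).
Proof.
move=> [szp coP]; split; first exact: leq_trans (size_scale_leq _ _) szp.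
by move=> n k; rewrite !coefCM coP coefZ; case: eqP; rewrite ?mulr0.
Qed.

Lemma bihomogenizationX (R : nzRingType) (d m : nat) (p : {poly R})
    (P : {poly {poly R}}) :
  bihomogenization d p P -> bihomogenization (d * m) (p ^+ m) (P ^+ m).
Proof.
move=> HP; elim: m => [|m IHm].
  by rewrite muln0; apply: bihomogenization1.
by rewrite !exprS mulnS; apply: bihomogenizationM.
Qed.

Lemma bihomogenization_prod (R : comNzRingType) (I : finType) (d : I -> nat)
    (p : I -> {poly R}) (P : I -> {poly {poly R}}) :
  (forall i, bihomogenization (d i) (p i) (P i)) ->
  bihomogenization (\sum_i d i) (\prod_i p i) (\prod_i P i).
Proof.
move=> HP.
suff H (s : seq I) : bihomogenization (\sum_(i <- s) d i) (\prod_(i <- s) p i)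
    (\prod_(i <- s) P i) by apply: H.
elim: s => [|i s IHs]; first by rewrite !big_nil; apply: bihomogenization1.
by rewrite !big_cons; apply: bihomogenizationM.
Qed.

(** * Waring polynomials and products of geometric sums *)

Lemma eq_coefM_le (R : nzRingType) (p p' q q' : {poly R}) (n : nat) :
  (forall i, (i <= n)%N -> p`_i = p'`_i) ->
  (forall i, (i <= n)%N -> q`_i = q'`_i) ->
  (p * q)`_n = (p' * q')`_n.
Proof.
move=> eqp eqq; rewrite !coefM; apply: eq_bigr => i _.
by rewrite eqp ?eqq ?leq_subr // -ltnS.
Qed.

Lemma natrS_neq0 (K : fieldType) (charK0 : [pchar K] =i pred0) (n : nat) :
  n.+1%:R != 0 :> K.
Proof. by rewrite ((pcharf0P K).1 charK0). Qed.

Lemma fps_powE (K : fieldType) (f : nat -> K) (B r n : nat) : (n < B)%N ->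
  fps_pow f r n = ((\poly_(i < B) f i) ^+ r)`_n.
Proof.
elim: r n => [|r IHr] n ltnB; first by rewrite expr0 coef1.
rewrite /fps_pow iterS -/(fps_pow f r) exprS coefM; apply: eq_bigr => i _.
have lei : (i <= n)%N by rewrite -ltnS.
rewrite coef_poly (leq_ltn_trans lei) // IHr //.
exact: leq_ltn_trans (leq_subr _ _) ltnB.
Qed.

Lemma fps_exp0 (K : fieldType) (f : nat -> K) : fps_exp f 0 = 1.
Proof. by rewrite /fps_exp big_ord1 divr1. Qed.

(** The coefficient form of [E' = f' E] for [E = exp f]. *)
Lemma fps_expS (K : fieldType) (charK0 : [pchar K] =i pred0) (f : nat -> K)
    (n : nat) : f 0%N = 0 ->
  fps_exp f n.+1 * n.+1%:R =
  \sum_(i < n.+1) f i.+1 * i.+1%:R * fps_exp f (n - i)%N.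
Proof.
move=> f0; pose B := n.+2; pose p := \poly_(i < B) f i.
pose E s := \sum_(r < s) (r`!%:R^-1) *: p ^+ r.
have expE m : (m < B)%N -> fps_exp f m = (E B)`_m.
  move=> ltmB; rewrite /fps_exp coef_sum.
  rewrite (big_ord_widen B (fun i => fps_pow f i m / i`!%:R)) // big_mkcond.
  apply: eq_bigr => r _; rewrite coefZ mulrC -fps_powE //.
  case: ltnP => // ltr; rewrite fps_pow_eq0 ?mulr0 //.
(* The derivative of the truncated exponential loses its last term, of order
   [n + 1], which is invisible below. *)
have derE : (E B)^`() = p^`() * E n.+1.
  rewrite /E big_ord_recl expr0 linearD /= derivZ derivC scaler0 add0r.
  rewrite raddf_sum mulr_sumr; apply: eq_bigr => r _ /=.
  rewrite derivZ deriv_exp /= -scaler_nat scalerA -scalerAr /bump add1n.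
  by rewrite factS natrM invfM mulrAC mulVf ?mul1r ?natrS_neq0.
rewrite expE // mulr_natr -coef_deriv derE.
rewrite (@eq_coefM_le _ _ (p^`()) _ (E B)) // => [|i lein]; last first.
  rewrite [E B]big_ord_recr coefD coefZ /= -fps_powE; last first.
    by rewrite ltnS (leqW lein).
  by rewrite fps_pow_eq0 // mulr0 addr0.
rewrite coefM; apply: eq_bigr => -[i lti] _ /=.
rewrite coef_deriv coef_poly ltnS lti mulr_natr expE //; lia.
Qed.

(** The formal identity [t p' = F p], where [F = \sum_(i >= 1) F_i t^i] is the
    power series [t p' / p]; it determines [p] from [p 0] in characteristic
    zero. *)
Definition has_log_deriv (R : nzRingType) (F : nat -> R) (p : {poly R}) :=
  forall n, p`_n.+1 *+ n.+1 = \sum_(i < n.+1) F i.+1 * p`_(n - i).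

Lemma has_log_derivP (R : nzRingType) (F : nat -> R) (p : {poly R}) (n : nat) :
  has_log_deriv F p ->
  forall i, (i <= n)%N -> p^`()`_i = ((\poly_(j < n.+1) F j.+1) * p)`_i.
Proof.
move=> Fp i lei; rewrite coef_deriv Fp coefM; apply: eq_bigr => -[j ltj] _ /=.
by rewrite coef_poly (leq_trans ltj).
Qed.

Lemma has_log_derivM (R : comNzRingType) (F G : nat -> R) (p q : {poly R}) :
  has_log_deriv F p -> has_log_deriv G q ->
  has_log_deriv (fun i => F i + G i) (p * q).
Proof.
move=> Fp Gq n; rewrite -coef_deriv derivM coefD.
rewrite (eq_coefM_le (has_log_derivP Fp (n:=n)) (fun=> fun=> erefl)).
rewrite (@eq_coefM_le _ p p _ _ n (fun=> fun=> erefl)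
           (has_log_derivP Gq (n:=n))).
rewrite mulrCA -mulrA -coefD -mulrDl coefM; apply: eq_bigr => -[i lti] _ /=.
by rewrite coefD !coef_poly lti.
Qed.

Lemma has_log_deriv1 (R : nzRingType) : has_log_deriv (fun=> 0) (1 : {poly R}).
Proof.
move=> n; rewrite coef1 mul0rn big1 // => i _; exact: mul0r.
Qed.

Lemma eq_has_log_deriv (R : nzRingType) (F G : nat -> R) (p : {poly R}) :
  (forall i, F i.+1 = G i.+1) -> has_log_deriv F p -> has_log_deriv G p.
Proof.
by move=> eqFG Fp n; rewrite Fp; apply: eq_bigr => i _; rewrite eqFG.
Qed.

Lemma has_log_derivX (R : comNzRingType) (F : nat -> R) (p : {poly R})
    (m : nat) :
  has_log_deriv F p -> has_log_deriv (fun i => F i *+ m) (p ^+ m).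
Proof.
move=> Fp; elim: m => [|m IHm]; first exact: has_log_deriv1.
rewrite exprS; apply: eq_has_log_deriv (has_log_derivM Fp IHm) => i.
by rewrite mulrS.
Qed.

Lemma has_log_deriv_prod (R : comNzRingType) (I : finType) (F : I -> nat -> R)
    (p : I -> {poly R}) :
  (forall i, has_log_deriv (F i) (p i)) ->
  has_log_deriv (fun j => \sum_i F i j) (\prod_i p i).
Proof.
move=> Fp.
suff H (s : seq I) : has_log_deriv (fun j => \sum_(i <- s) F i j)
    (\prod_(i <- s) p i) by apply: H.
elim: s => [|i s IHs].
  rewrite big_nil; apply: eq_has_log_deriv (has_log_deriv1 R) => j.
  by rewrite big_nil.
rewrite big_cons; apply: eq_has_log_deriv (has_log_derivM (Fp i) IHs) => j.
by rewrite big_cons.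
Qed.

Lemma fps_exp_unique (K : fieldType) (charK0 : [pchar K] =i pred0)
    (f : nat -> K) (p : {poly K}) :
  f 0%N = 0 -> p`_0 = 1 -> has_log_deriv (fun i => f i * i%:R) p ->
  forall n, fps_exp f n = p`_n.
Proof.
move=> f0 p0 Fp; elim/ltn_ind => -[|n] IHn; first by rewrite fps_exp0.
apply: (mulIf (natrS_neq0 charK0 n)); rewrite fps_expS // mulr_natr Fp.
by apply: eq_bigr => i _; rewrite IHn // ltnS leq_subr.
Qed.

(** [1 + t + ... + t^(j-1) = (1 - t^j) / (1 - t)]. *)
Definition geom (R : nzRingType) (j : nat) : {poly R} := \poly_(i < j) 1.

(** As [geom j = (1 - t^j) / (1 - t)], its logarithmic derivative times [t] is
    [t / (1 - t) - j t^j / (1 - t^j)]. The induction compares the convolutions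
    for [n] and [n + 1]: the window of [j] consecutive indices,
    once complete, moves by one and always contains one multiple of [j]. *)
Lemma has_log_deriv_geom (R : nzRingType) (j : nat) :
  has_log_deriv (fun i => 1 - (j * (j %| i))%N%:R) (geom R j).
Proof.
move=> n; rewrite /geom.
under eq_bigr do rewrite coef_poly.
rewrite coef_poly.
case: j => [|j].
  by rewrite ltn0 mul0rn big1 // => i _; rewrite ltn0 mulr0.
elim: n => [|n IHn].
  rewrite big_ord1 /= mulr1 dvdn1 eqSS ltnS.
  by case: j => [|j]; rewrite /= ?muln0 ?muln1 ?subrr ?subr0.
rewrite big_ord_recr /= subnn ltn0Sn mulr1.
have -> : \sum_(i < n.+1) (1 - (j.+1 * (j.+1 %| i.+1))%N%:R)
              * (if (n.+1 - i < j.+1)%N then 1 else 0) =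
    \sum_(i < n.+1) (1 - (j.+1 * (j.+1 %| i.+1))%N%:R)
              * (if (n - i < j.+1)%N then 1 else 0)
    - (if (j <= n)%N then 1 - (j.+1 * (j.+1 %| n.+2))%N%:R else 0) :> R.
  have -> : (if (j <= n)%N then 1 - (j.+1 * (j.+1 %| n.+2))%N%:R else 0) =
      \sum_(i < n.+1) (if (n - i == j)%N
                       then 1 - (j.+1 * (j.+1 %| i.+1))%N%:R else 0) :> R.
    case: leqP => [lejn|ltnj]; last first.
      by rewrite big1 // => -[i lti] _; rewrite ifN //=; lia.
    have ltjn : (n - j < n.+1)%N by lia.
    rewrite (bigD1 (Ordinal ltjn)) //= subKn // eqxx.
    rewrite big1 => [|[i lti] /eqP nei].
      have -> : n.+2 = ((n - j).+1 + j.+1)%N by lia.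
      by rewrite addr0 dvdn_addl.
    rewrite ifN //=; apply/eqP => eij; apply: nei; apply: val_inj => /=; lia.
  rewrite -sumrB; apply: eq_bigr => -[i lti] _ /=.
  have -> : (n.+1 - i < j.+1)%N = (n - i < j)%N by lia.
  rewrite ltnS; case: ltngtP => _; rewrite ?mulr0 ?mulr1 ?subr0 ?subrr //.
rewrite -IHn !ltnS.
have [lejn|ltnj] := leqP j n.
  by rewrite ifN ?mul0rn ?sub0r ?addNr //; lia.
rewrite subr0; have [->|nej] := eqVneq j n.+1.
  by rewrite ltnn dvdnn muln1 mul0rn addrA -mulrSr subrr.
have ltnSj : (n.+1 < j)%N by lia.
by rewrite ltnSj gtnNdvd // muln0 subr0 -mulrSr.
Qed.

(** * The logarithmic series *)

(** The part [b_(i+1) (x^i y + x^(i-1) y^2 + ... + x y^i)] of [1 - H]. *)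
Definition log_term (K : fieldType) (b : nat -> K) (i : nat) :
    {poly {poly K}} :=
  \poly_(n < i.+1) (if n == 0%N then 0 else b i.+1 *: 'X^(i.+1 - n)).

Lemma log_term_bihomogenization (K : fieldType) (b : nat -> K) (i : nat) :
  bihomogenization i.+1 (b i.+1 *: ('X * geom K i)) (log_term b i).
Proof.
split.
  apply: leq_trans (size_scale_leq _ _) _.
  apply: leq_trans (size_polyMleq _ _) _.
  by rewrite size_polyX add2n ltnS leqW // size_poly.
move=> n k; rewrite coef_poly coefZ coefXM /geom coef_poly.
case: n => [|n]; case: k => [|k] /=.
- by rewrite coef0.
- by rewrite coef0 add0n eqSS; case: eqP => // ->; rewrite ltnn mulr0.
- rewrite mulr0 if_same; case: ifP => lti; last by rewrite coef0.
  by rewrite coefZ coefXn (_ : (0 == _ :> nat)%N = false) ?mulr0 //; lia.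
rewrite addnS eqSS; case: eqP => [<-|nek].
  rewrite ltnS leq_addr coefZ coefXn ifT; last by lia.
  by rewrite (_ : (_ == _ :> nat)%N = true) //; lia.
case: ifP => lti; last by rewrite coef0.
by rewrite coefZ coefXn (_ : (_ == _ :> nat)%N = false) ?mulr0 //; lia.
Qed.

(** The polynomial [1 - H], with [b_j] replaced by 0 for [j > N]. *)
Definition log_arg (K : fieldType) (b : nat -> K) (N : nat) : {poly {poly K}} :=
  \sum_(i < N) log_term b i.

Lemma log_arg_y0 (K : fieldType) (b : nat -> K) (N : nat) :
  (log_arg b N)`_0 = 0.
Proof. by rewrite coef_sum big1 // => i _; rewrite coef_poly. Qed.

Lemma log_arg_x0 (K : fieldType) (b : nat -> K) (N n : nat) :
  (log_arg b N)`_n`_0 = 0.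
Proof.
rewrite !coef_sum big1 // => i _.
by rewrite (log_term_bihomogenization b i).2 coefZ coefXM mulr0 if_same.
Qed.

Lemma log_arg_coefS (K : fieldType) (b : nat -> K) (N n k : nat) :
  (n + k + 2 <= N)%N -> (log_arg b N)`_n.+1`_k.+1 = b (n + k).+2.
Proof.
move=> leN; have ltN : ((n + k).+1 < N)%N by lia.
rewrite !coef_sum (bigD1 (Ordinal ltN)) //= big1 => [|[i lti] /eqP nei].
  rewrite (log_term_bihomogenization b _).2 ifT; last by lia.
  by rewrite coefZ coefXM coef_poly /= ltnS leq_addl mulr1 addr0.
rewrite (log_term_bihomogenization b _).2 ifN //=.
by apply/eqP => eni; apply: nei; apply: val_inj => /=; lia.
Qed.

Lemma coefX_eq0 (R : nzRingType) (p : {poly R}) (r n : nat) :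
  p`_0 = 0 -> (n < r)%N -> (p ^+ r)`_n = 0.
Proof.
move=> p0; elim: r n => // r IHr n ltn.
rewrite exprS coefM big1 // => -[[|j] ltj] _ /=; first by rewrite p0 mul0r.
by rewrite IHr ?mulr0 //; lia.
Qed.

(** [- ln H], truncated: as [1 - H] has no constant term, the powers beyond the
    [N]-th only contain monomials of degree larger than [N]. *)
Definition log_series (K : fieldType) (b : nat -> K) (N : nat) :
    {poly {poly K}} :=
  \sum_(r < N) (r.+1%:R^-1)%:P%:P * log_arg b N ^+ r.+1.

Lemma deriv_log_series (K : fieldType) (charK0 : [pchar K] =i pred0)
    (b : nat -> K) (N : nat) :
  (log_series b N)^`() = (log_arg b N)^`() * \sum_(r < N) log_arg b N ^+ r.
Proof.
rewrite /log_series raddf_sum mulr_sumr; apply: eq_bigr => r _ /=.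
rewrite mul_polyC derivZ deriv_exp /= -mul_polyC mulrnAr -mulrnAl.
by rewrite -!polyCMn -[_^-1 *+ _]mulr_natr mulVf ?mul1r // natrS_neq0.
Qed.

Lemma deriv_log_series_x0 (K : fieldType) (charK0 : [pchar K] =i pred0)
    (b : nat -> K) (N n : nat) :
  (log_series b N)^`()`_n`_0 = 0.
Proof.
rewrite deriv_log_series // coefM coef_sum big1 // => i _.
by rewrite coef0M coef_deriv coefMn log_arg_x0 mul0rn mul0r.
Qed.

(** Compare coefficients in [L' = Q' + Q L' - Q' Q^N], where [Q = 1 - H] and
    [L] is the truncation of [- ln (1 - Q)]; the last term has order at least
    [N] in [y] and does not contribute. *)
Lemma log_series_rec (K : fieldType) (charK0 : [pchar K] =i pred0)
    (b : nat -> K) (N n k : nat) : (n + k + 2 <= N)%N ->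
  (log_series b N)^`()`_n`_k.+1 =
    n.+1%:R * b (n + k).+2
    + \sum_(a < n) \sum_(c < k)
        b (a + c).+2 * (log_series b N)^`()`_(n - a).-1`_(k - c).
Proof.
move=> leN; set L := (log_series b N)^`(); set Q := log_arg b N.
have LE : L = Q^`() + Q * L - Q^`() * Q ^+ N.
  have := subrX1 Q N; rewrite /L deriv_log_series // -/Q.
  set S := \sum_(i < N) Q ^+ i; move=> QN.
  rewrite -[Q ^+ N](subrK 1) QN; ring.
rewrite {1}LE coefB [X in _ - X](_ : _ = 0) ?subr0; last first.
  rewrite coefM big1 // => -[i lti] _ /=.
  by rewrite coefX_eq0 ?mulr0 ?log_arg_y0 //; lia.
rewrite !coefD coef_deriv coefMn log_arg_coefS // mulr_natl; congr (_ + _).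
rewrite coefM big_ord_recl log_arg_y0 mul0r add0r coef_sum.
apply: eq_bigr => -[a lta] _; rewrite /= /bump /= add1n.
rewrite coefM big_ord_recl log_arg_x0 mul0r add0r.
rewrite big_ord_recr /= /bump /= add1n subSS subnn deriv_log_series_x0 //.
rewrite mulr0 addr0; apply: eq_bigr => -[c ltc] _ /=.
rewrite add1n log_arg_coefS; last by lia.
by rewrite !subSS subnS.
Qed.

(** Both sides satisfy the same recursion: [\beta_nk] is the coefficient of
    [x^k y^(n-1)] in the [y]-derivative of [- ln H]. *)
Lemma grunsky_log (K : fieldType) (charK0 : [pchar K] =i pred0)
    (b : nat -> K) (N n k : nat) : (n + k + 2 <= N)%N ->
  grunsky b n.+1 k.+1 = (log_series b N)^`()`_n`_k.+1.
Proof.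
elim/ltn_ind: n k => n IHn k leN.
rewrite grunsky_rec log_series_rec //; congr (_ + _).
apply: eq_bigr => -[a lta] _; apply: eq_bigr => -[c ltc] _ /=.
have [-> ->] : (n - a = (n - a).-1.+1 /\ k - c = (k - c).-1.+1)%N by lia.
by rewrite IHn //=; lia.
Qed.

(** * Expansion over multi-indices *)

Lemma big_mi_seq (R : Type) (idx : R) (op : Monoid.law idx) (N : nat)
    (t : N.-tuple 'I_N.+1) (F : nat -> R) :
  \big[op/idx]_(1 <= j < (size (mi_seq t)).+1) F j =
  \big[op/idx]_(i < N) F i.+1.
Proof. by rewrite big_add1 /= /mi_seq size_map size_tuple big_mkord. Qed.

Lemma mi_entry_tnth (N : nat) (t : N.-tuple 'I_N.+1) (i : 'I_N) :
  mi_entry (mi_seq t) i.+1 = tnth t i.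
Proof.
by rewrite /mi_entry /mi_seq /= (nth_map ord0) ?size_tuple // (tnth_nth ord0).
Qed.

(** The term [i = 1] vanishes because the logarithmic derivative of
    [geom 1 = 1] does, the term [i = 0] because [m_1 = 0]. *)
Lemma mi_L_sum (K : fieldType) (N : nat) (t : N.-tuple 'I_N.+1) (p : nat) :
  mi_entry (mi_seq t) 1 = 0%N ->
  \sum_(i < N) (1 - (i * (i %| p.+1))%N%:R) *+ tnth t i
  = - mi_L K (mi_seq t) p.+1.
Proof.
move=> t0; rewrite /mi_L opprD opprK.
rewrite /mi_seq size_map size_tuple -/(mi_seq t).
have sum2 (P : pred nat) (F : nat -> nat) :
    (\sum_(2 <= j < N | P j) F j * mi_entry (mi_seq t) j.+1 =
     \sum_(i < N | P i && (2 <= i)) F i * tnth t i)%N.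
  rewrite big_geq_mkord; apply: eq_big => i; first by rewrite andbC.
  by rewrite mi_entry_tnth.
have -> : (\sum_(2 <= j < N) mi_entry (mi_seq t) j.+1
          = \sum_(2 <= j < N) 1 * mi_entry (mi_seq t) j.+1)%N.
  by apply: eq_bigr => j _; rewrite mul1n.
rewrite !sum2 !natr_sum [X in _ = X - _]big_mkcond.
rewrite [X in _ = _ - X]big_mkcond -sumrB.
apply: eq_bigr => i _; case: i => -[|[|i]] lti /=.
- by rewrite -mi_entry_tnth t0 mulr0n subrr.
- by rewrite dvd1n !muln1 !subrr mul0rn.
rewrite mul1n andbT; case: (_ %| _)%N.
  by rewrite muln1 mulrnBl -mulrnA.
by rewrite muln0 !subr0.
Qed.

Lemma coef0_geom_prod (K : fieldType) (N : nat) (t : N.-tuple 'I_N.+1) :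
  mi_entry (mi_seq t) 1 = 0%N ->
  (\prod_(i < N) geom K i ^+ tnth t i)`_0 = 1.
Proof.
move=> t0; rewrite coef0_prod big1 // => i _.
rewrite -horner_coef0 horner_exp horner_coef0 coef_poly.
case: i => -[|i] lti /=; last by rewrite expr1n.
by rewrite -mi_entry_tnth t0.
Qed.

(** By definition the Waring polynomials at [L] are the coefficients of
    [exp (- \sum_p L_p t^p / p)], and [- L_p] are those of [t T' / T] for
    [T = \prod_i (1 + ... + t^(i-1))^(m_(i+1))]. Hence the two series are
    equal. *)
Lemma waring_mi_L (K : fieldType) (charK0 : [pchar K] =i pred0) (N : nat)
    (t : N.-tuple 'I_N.+1) (k a : nat) :
  mi_entry (mi_seq t) 1 = 0%N ->
  waring (mi_L K (mi_seq t)) (k%:Z - a%:Z) =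
  ('X^a * \prod_(i < N) geom K i ^+ tnth t i)`_k.
Proof.
move=> t0; rewrite coefXnM; case: ltnP => [ltka|leak].
  by rewrite (_ : k%:Z - a%:Z = Negz (a - k).-1) // NegzE; lia.
rewrite subzn //=.
rewrite (@fps_exp_unique _ _ _ (\prod_(i < N) geom K i ^+ tnth t i)) //.
  exact: coef0_geom_prod.
have LD i := has_log_derivX (tnth t i) (has_log_deriv_geom K i).
apply: eq_has_log_deriv (has_log_deriv_prod LD) => p /=.
by rewrite mi_L_sum // mulNr divfK // natrS_neq0.
Qed.

(** Each power of [1 - H] is expanded by the multinomial theorem. A monomial
    with exponents [m] is homogeneous of degree [||m||], so that of its
    coefficients only those of [x^k y^n] with [n + k = ||m||] survive, and these
    are read off at [y = 1], where the [i]-th term of [1 - H] becomes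
    [b_(i+1) x (1 + ... + x^(i-1))]. The index [m] comes from the power [|m|]
    alone, and [1 / |m|] times [|m|!] is [(|m|-1)!]. *)
Lemma log_series_coef (K : fieldType) (charK0 : [pchar K] =i pred0)
    (b : nat -> K) (n k : nat) : (0 < n + k)%N ->
  (log_series b (n + k))`_n`_k =
  \sum_(t : (n + k).-tuple 'I_(n + k).+1 | (mi_norm (mi_seq t) == n + k)%N)
     (mi_abs (mi_seq t)).-1`!%:R * (mi_fact (mi_seq t))%:R^-1
     * mi_pow b (mi_seq t)
     * ('X^(mi_abs (mi_seq t)) * \prod_(i < n + k) geom K i ^+ tnth t i)`_k.
Proof.
set N := (n + k)%N => N_gt0.
pose iv r : {poly {poly K}} := (r`!%:R^-1)%:P%:P.
have fact_neq0 r : r`!%:R != 0 :> K.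
  by rewrite ((pcharf0P K).1 charK0) -lt0n fact_gt0.
have ivP r : iv r * r`!%:R = 1.
  rewrite /iv -!polyC_natr -!polyCM mulVf //.
pose X (f : {ffun 'I_N -> 'I_N.+1}) :=
  \prod_i (iv (f i) * log_term b i ^+ f i).
pose x (f : {ffun 'I_N -> 'I_N.+1}) :=
  \prod_i ((f i)`!%:R^-1 *: (b i.+1 *: ('X * geom K i)) ^+ f i).
have homX (f : {ffun 'I_N -> 'I_N.+1}) :
    bihomogenization (\sum_(i < N) i.+1 * f i) (x f) (X f).
  apply: bihomogenization_prod => i.
  apply: bihomogenizationZ; apply: bihomogenizationX.
  exact: log_term_bihomogenization.
have -> : log_series b N =
    \sum_(r < N) r`!%:R%:P%:P *
      \sum_(f : {ffun 'I_N -> 'I_N.+1} | (\sum_i f i == r.+1)%N) X f.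
  apply: eq_bigr => r _; rewrite -multinomial // mulrA -!polyCM.
  by rewrite factS natrM invfM mulrCA divff // mulr1.
rewrite !coef_sum.
under eq_bigr => r _.
  rewrite !coefCM !coef_sum mulr_sumr.
  under eq_bigr => f _ do rewrite (homX f).2.
  rewrite big_mkcond; over.
(* Sum over the exponent vector first: each one picks its own power [r + 1]. *)
rewrite exchange_big /=.
rewrite (reindex (fun t : N.-tuple 'I_N.+1 => [ffun i => tnth t i])); last first.
  exists (fun f : {ffun 'I_N -> 'I_N.+1} => [tuple f i | i < N]) => [t _|f _].
    by apply: eq_from_tnth => i; rewrite tnth_mktuple ffunE.
  by apply/ffunP => i; rewrite ffunE tnth_mktuple.
rewrite [RHS]big_mkcond; apply: eq_bigr => t _.
have -> : mi_norm (mi_seq t) = (\sum_(i < N) i.+1 * tnth t i)%N.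
  by rewrite /mi_norm big_mi_seq; apply: eq_bigr => i _; rewrite mi_entry_tnth.
have absE : mi_abs (mi_seq t) = (\sum_(i < N) tnth t i)%N.
  by rewrite /mi_abs big_mi_seq; apply: eq_bigr => i _; rewrite mi_entry_tnth.
have -> : mi_fact (mi_seq t) = (\prod_(i < N) (tnth t i)`!)%N.
  by rewrite /mi_fact big_mi_seq; apply: eq_bigr => i _; rewrite mi_entry_tnth.
have -> : mi_pow b (mi_seq t) = \prod_(i < N) b i.+1 ^+ tnth t i.
  by rewrite /mi_pow big_mi_seq; apply: eq_bigr => i _; rewrite mi_entry_tnth.
set f := [ffun i => tnth t i].
have sumf : (\sum_i f i = mi_abs (mi_seq t))%N.
  by rewrite absE; apply: eq_bigr => i _; rewrite ffunE.
have normf : (\sum_(i < N) i.+1 * f i = \sum_(i < N) i.+1 * tnth t i)%N.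
  by apply: eq_bigr => i _; rewrite ffunE.
rewrite sumf normf -/N eq_sym.
case: eqP => [normE|_]; last by rewrite big1 // => r _; rewrite mulr0 if_same.
have abs_gt0 : (0 < mi_abs (mi_seq t))%N.
  rewrite lt0n absE; apply/eqP => /eqP; rewrite sum_nat_eq0 => /forallP abs0.
  move: N_gt0; rewrite [N in (0 < N)%N](esym normE) big1 // => i _.
  by rewrite (eqP (abs0 i)) muln0.
have abs_le : ((mi_abs (mi_seq t)).-1 < N)%N.
  rewrite prednK // absE [leqRHS](esym normE).
  by apply: leq_sum => i _; apply: leq_pmull.
rewrite (bigD1 (Ordinal abs_le)) //= prednK // eqxx.
rewrite big1 ?addr0 => [|r ner]; last first.
  rewrite ifN //; apply: contra ner => /eqP rE; apply/eqP/val_inj => /=.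
  by rewrite rE.
rewrite -!mulrA; congr (_ * _).
have -> : x f =
    ((\prod_(i < N) (tnth t i)`!)%N%:R^-1 * \prod_(i < N) b i.+1 ^+ tnth t i)
    *: ('X^(mi_abs (mi_seq t)) * \prod_(i < N) geom K i ^+ tnth t i).
  rewrite absE -prodrXr -big_split natr_prod -prodfV -big_split -scaler_prod.
  apply: eq_bigr => i _ /=.
  by rewrite ffunE exprZn exprMn scalerA.
by rewrite coefZ mulrA.
Qed.

Theorem proposition3p3 (K : fieldType) (charK0 : [pchar K] =i pred0)
    (b : nat -> K) (n k : nat) (n_ge1 : (1 <= n)%N) (k_ge1 : (1 <= k)%N) :
  grunsky b n k =
    n%:R * \sum_(t : (n + k).-tuple 'I_(n + k).+1
                  | (mi_norm (mi_seq t) == n + k)%N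
                    && (mi_entry (mi_seq t) 1 == 0)%N)
             mi_pow b (mi_seq t) * (((mi_abs (mi_seq t)).-1)`!)%:R
               / (mi_fact (mi_seq t))%:R
             * waring (mi_L K (mi_seq t))
                      (k%:Z - (mi_abs (mi_seq t))%:Z).
Proof.
transitivity (n%:R * (log_series b (n + k))`_n`_k).
  case: n k n_ge1 k_ge1 => [//|n] [//|k] _ _.
  rewrite (@grunsky_log _ charK0 _ (n.+1 + k.+1)); last by lia.
  by rewrite coef_deriv coefMn mulr_natl.
rewrite log_series_coef //; last by lia.
congr (_ * _); rewrite [RHS]big_mkcondr; apply: eq_bigr => t _.
case: eqP => [t0|/eqP t0].
  by rewrite waring_mi_L //; congr (_ * _); ring.
have N_gt0 : (0 < n + k)%N by lia.
(* The factor of index 0 is a positive power of the empty sum. *)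
rewrite (bigD1 (Ordinal N_gt0)) //=.
rewrite -(mi_entry_tnth t (Ordinal N_gt0)) /=.
have -> : geom K 0 = 0 by apply/polyP => i; rewrite coef_poly coef0.
by rewrite expr0n (negPf t0) mul0r mulr0 coef0 mulr0.
Qed.
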